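(* Let $\mathbf{W}:\mathrm{dom}(\mathbf{W})\to\mathcal{H}$ be a (possibly unbounded) self-adjoint operator on the Hilbert space $\mathcal{H}$ such that $\ker(\mathbf{W})=\{0\}$, let $\mathcal{H}_{\mathbf{W}}$ be the associated Krein space, and let $\mathbf{U}:\mathcal{H}_{\mathbf{W}}\to\mathcal{H}$ denote the $J$-unitary operator extending $\sqrt{|\mathbf{W}|}$. Let $(\mathcal{M},\mathfrak{B},\nu)$ be a signed measure space. Then: (i) $\{\eta_x^1,\ldots,\eta_x^n\}_{x\in\mathcal{M}}$ is a continuous frame of rank $n\in\mathbb{N}$ for the Hilbert space $\mathcal{H}$ with respect to $(\mathcal{M},\mathfrak{B},\nu)$ and with frame bounds $a\le b$ if and only if $\{\mathbf{U}^{-1}\eta_x^1,\ldots,\mathbf{U}^{-1}\eta_x^n\}_{x\in\mathcal{M}}$ is a continuous frame of rank $n$ for the Krein space $\mathcal{H}_{\mathbf{W}}$ with respect to $(\mathcal{M},\mathfrak{B},\nu)$ and with frame bounds $a\le b$. (ii) If $\{\eta_x^1,\ldots,\eta_x^n\}_{x\in\mathcal{M}}\subset\mathrm{dom}(\sqrt{|\mathbf{W}|}^{\,-1})$ is a continuous frame of rank $n\in\mathbb{N}$ for the Hilbert space $\mathcal{H}$ with respect to $(\mathcal{M},\mathfrak{B},\nu)$, then the continuous frame $\{\mathbf{U}^{-1}\eta_x^1,\ldots,\mathbf{U}^{-1}\eta_x^n\}_{x\in\mathcal{M}}$ for the Krein space $\mathcal{H}_{\mathbf{W}}$ is given by $\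{\sqrt{|\mathbf{W}|}^{\,-1}\eta_x^1,\ldots,\sqrt{|\mathbf{W}|}^{\,-1}\eta_x^n\}_{x\in\mathcal{M}}$.
   Context: All spaces are complex; inner products are conjugate-linear in the first and linear in the second variable. A Krein space $(\mathcal{K},[\cdot,\cdot])$ comes with a fundamental decomposition $\mathcal{K}=\mathcal{K}_+[\dotplus]\mathcal{K}_-$ (a direct sum, orthogonal with respect to $[\cdot,\cdot]$, such that $(\mathcal{K}_+,[\cdot,\cdot])$ and $(\mathcal{K}_-,-[\cdot,\cdot])$ are Hilbert spaces) and fundamental symmetry $J(k^++k^-)=k^+-k^-$; $[h,k]_J:=[h,Jk]$ is a Hilbert space inner product with $J$-norm $\|\cdot\|_J$. A Hilbert space is regarded as a Krein space with fundamental symmetry the identity. Construction of $\mathcal{H}_{\mathbf{W}}$. Let $\mathbf{W}=J|\mathbf{W}|$ be the polar decomposition of $\mathbf{W}$ on $(\mathcal{H},\langle\cdot,\cdot\rangle)$; since $\ker\mathbf{W}=\{0\}$, $J=\mathbf{E}(0,\infty)-\mathbf{E}(-\infty,0)$ is a self-adjoint unitary, $\mathbf{E}$ being the spectral measure of $\mathbf{W}$. On $\mathrm{dom}(\mathbf{W})$ put $[f,g]:=\langle f,\mathbf{W}g\rangle$ and $[f,g]_J:=[f,Jg]=\langle f,|\mathbf{W}|g\rangle$. The completion of $\mathrm{dom}(\mathbf{W})$ in the norm $\|f\|_J=\sqrt{[f,f]_J}$, with $[\cdot,\cdot]$ and $J$ extended by continuity, is the Krein space $(\mathcal{H}_{\mathbf{W}},[\cdot,\cdot])$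 with fundamental symmetry $J$. Since $\mathrm{dom}(\mathbf{W})$ is dense in $\mathrm{dom}(\sqrt{|\mathbf{W}|})$ for the norm $\|\sqrt{|\mathbf{W}|}f\|$, which equals $\|f\|_J$ on $\mathrm{dom}(\mathbf{W})$, the space $\mathrm{dom}(\sqrt{|\mathbf{W}|})$ is regarded as a dense subspace of $\mathcal{H}_{\mathbf{W}}$. The operator $\sqrt{|\mathbf{W}|}:\mathrm{dom}(\sqrt{|\mathbf{W}|})\to\mathcal{H}$ is isometric with respect to $\|\cdot\|_J$ and the norm of $\mathcal{H}$, and $\mathbf{U}:\mathcal{H}_{\mathbf{W}}\to\mathcal{H}$ is its continuous extension, which is $J$-unitary, i.e. a surjective isometry from the Hilbert space $(\mathcal{H}_{\mathbf{W}},[\cdot,\cdot]_J)$ onto $(\mathcal{H},\langle\cdot,\cdot\rangle)$. Here $\mathrm{dom}(\sqrt{|\mathbf{W}|}^{\,-1})$ is the range of $\sqrt{|\mathbf{W}|}$. Continuous frames. $\nu$ is a signed measure on $(\mathcal{M},\mathfrak{B})$ with total variation $|\nu|$. A map $\eta:\mathcal{M}\to\mathcal{K}$ into a Krein space is weakly measurable if $x\mapsto[\eta(x),k]$ is measurable for every $k\in\mathcal{K}$. A family $\{\eta_x^1,\ldots,\eta_x^n\}_{x\in\mathcal{M}}$ in $\mathcal{K}$, with $\eta_x^1,\ldots,\eta_x^n$ linearly independent for each $x$, is a continuous frame of rank $n$ for $\mathcal{K}$ with respect to $(\mathcal{M},\mathfrak{B},\nu)$ with frame bounds $0<a\le b$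 if each $x\mapsto\eta_x^i$ is weakly measurable and $a\|k\|_J^2\le\sum_{i=1}^n\int_{\mathcal{M}}|[\eta_x^i,k]|^2\,d|\nu|(x)\le b\|k\|_J^2$ for all $k\in\mathcal{K}$. For the Hilbert space $\mathcal{H}$ one uses $\langle\cdot,\cdot\rangle$ and its norm. *)

(* Defs.v *)
From HB Require Import structures.
From mathcomp Require Import all_boot all_order all_algebra.
From mathcomp Require Import all_classical all_reals all_analysis.
From mathcomp Require Import complex.

Set Implicit Arguments.
Unset Strict Implicit.
Unset Printing Implicit Defensive.

Import Order.TTheory GRing.Theory Num.Theory.
Import numFieldNormedType.Exports.

Local Open Scope classical_set_scope.
Local Open Scope ring_scope.

Section Forms.
Variables (R : realType) (V : lmodType R[i]).
Implicit Types (b : V -> V -> R[i]) (D : set V) (f g h : V) (u : nat -> V).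

Definition lin_subspace D : Prop :=
  D 0 /\ forall (a : R[i]) f g, D f -> D g -> D (a *: f + g).

(* Linear in the second variable; conjugate-linearity in the first one follows
   from the Hermitian symmetry. *)
Definition hermitian_form b : Prop :=
  (forall (a : R[i]) f g h, b f (a *: g + h) = a * b f g + b f h) /\
  (forall f g, b g f = conjc (b f g)).

Definition form_norm b f : R := Num.sqrt (complex.Re (b f f)).

Definition form_cvg b u f : Prop :=
  form_norm b (u n - f) @[n --> \oo] --> (0 : R).

Definition form_cauchy b u : Prop :=
  forall e : R, 0 < e ->
    exists N : nat, forall m n : nat, (N <= m)%N -> (N <= n)%N ->
      form_norm b (u m - u n) < e.

Definition hilbert_on b D : Prop :=
  [/\ lin_subspace D,
      (forall f, D f -> f != 0 -> 0 < b f f) &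
      (forall u, (forall n, D (u n)) -> form_cauchy b u ->
         exists2 f, D f & form_cvg b u f)].

Definition dense_for b D : Prop :=
  forall f (e : R), 0 < e -> exists2 g, D g & form_norm b (f - g) < e.

Definition lin_indep (n : nat) (v : 'I_n -> V) : Prop :=
  forall c : 'I_n -> R[i], \sum_(i < n) c i *: v i = 0 -> forall i, c i = 0.

End Forms.

Record hilbertSpace (R : realType) := HilbertSpace {
  hcarrier :> lmodType R[i];
  hip : hcarrier -> hcarrier -> R[i];
  hip_hermitian : hermitian_form hip;
  hip_hilbert : hilbert_on hip setT }.

Definition hnorm (R : realType) (H : hilbertSpace R) : H -> R :=
  form_norm (@hip R H).

Record kreinSpace (R : realType) := KreinSpace {
  kcarrier :> lmodType R[i];
  kform : kcarrier -> kcarrier -> R[i];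
  kpos : set kcarrier;
  kneg : set kcarrier;
  kform_hermitian : hermitian_form kform;
  kdecomp : forall k, exists p m, [/\ kpos p, kneg m & k = p + m];
  kdirect : kpos `&` kneg = [set 0];
  korth : forall p m, kpos p -> kneg m -> kform p m = 0;
  kpos_hilbert : hilbert_on kform kpos;
  kneg_hilbert : hilbert_on (fun h k => - kform h k) kneg }.

Section Krein.
Variables (R : realType) (K : kreinSpace R).

Definition fund_sym (k : K) : K :=
  xget 0 [set w | exists p m, [/\ kpos p, kneg m, k = p + m & w = p - m]].

Lemma fund_symE (p m : K) : kpos p -> kneg m -> fund_sym (p + m) = p - m.
Proof.
move=> Kp Km; rewrite /fund_sym; case: xgetP => [w _ [p' [m' [Kp' Km' e ->]]]|].
  have [[p0 pD] _ _] := kpos_hilbert K; have [[n0 nD] _ _] := kneg_hilbert K.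
  have e' : p - p' = m' - m.
    by apply/eqP; rewrite subr_eq addrAC eq_sym subr_eq addrC -e addrC.
  have Ip : kpos (p - p') by rewrite addrC -scaleN1r; exact: pD.
  have In : kneg (p - p') by rewrite e' addrC -scaleN1r; exact: nD.
  have : (@kpos R K `&` @kneg R K) (p - p') by split.
  rewrite kdirect /= => /eqP; rewrite subr_eq0 => /eqP pp'.
  by move: e; rewrite pp' => /addrI ->.
by move=> /(_ (p - m)); case; exists p, m.
Qed.

Definition jip (h k : K) : R[i] := kform h (fund_sym k).

Definition jnorm : K -> R := form_norm jip.

End Krein.

Section Operators.
Variable R : realType.

(* The values of an operator outside of its domain are meaningless, hence
   operators are compared with op_eq. *)
Record operator (V : lmodType R[i]) := Operator {
  dom : set V;
  opapp :> V -> V }.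

Definition linear_on (V X : lmodType R[i]) (D : set V) (T : V -> X) : Prop :=
  lin_subspace D /\
  forall (a : R[i]) f g, D f -> D g -> T (a *: f + g) = a *: T f + T g.

Definition op_eq (V : lmodType R[i]) (A B : operator V) : Prop :=
  dom A = dom B /\ forall f, dom A f -> A f = B f.

Definition op_comp (V : lmodType R[i]) (A B : operator V) : operator V :=
  Operator [set f | dom B f /\ dom A (B f)] (fun f => A (B f)).

Definition op_inv (V : lmodType R[i]) (A : operator V) : operator V :=
  Operator (A @` dom A) ('pinv_(fun=> 0) (dom A) A).

Variable H : hilbertSpace R.
Implicit Types (W A S T : operator H) (J : {linear H -> H}).

Definition adjoint_at W (g : H) : set H :=
  [set h | forall f, dom W f -> hip (W f) g = hip f h].

Definition adjoint W : operator H :=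
  Operator [set g | adjoint_at W g !=set0] (fun g => xget 0 (adjoint_at W g)).

Definition self_adjoint W : Prop :=
  [/\ linear_on (dom W) W, dense_for (@hip R H) (dom W) & op_eq (adjoint W) W].

(* In the order of R[i], 0 <= z means that z is real and nonnegative. *)
Definition positive_op A : Prop := forall f, dom A f -> 0 <= hip f (A f).

Definition is_positive_sqrt S T : Prop :=
  [/\ self_adjoint S, positive_op S & op_eq (op_comp S S) T].

(* |W| = sqrt (W^* W) *)
Definition is_abs A W : Prop := is_positive_sqrt A (op_comp (adjoint W) W).

Definition partial_isometry J : Prop :=
  forall f, (forall g, J g = 0 -> hip g f = 0) -> hnorm (J f) = hnorm f.

(* W = J A is the polar decomposition of W, with A = |W|. *)
Definition is_polar W J A : Prop :=
  [/\ is_abs A W, partial_isometry J,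
      (forall f, J f = 0 <-> dom W f /\ W f = 0) &
      op_eq W (Operator (dom A) (fun f => J (A f)))].

Variable K : kreinSpace R.

(* K is the Krein space obtained by completing dom W, j being the inclusion of
   dom W into its completion: the form and the fundamental symmetry of K extend
   those of dom W, and dom W is dense for the J-norm. *)
Definition is_HW W J (j : H -> K) : Prop :=
  [/\ linear_on (dom W) j,
      (forall f g, dom W f -> dom W g -> kform (j f) (j g) = hip f (W g)),
      (forall f, dom W f -> fund_sym (j f) = j (J f)) &
      dense_for (@jip R K) (j @` dom W)].

(* j, restricted to dom S with S = sqrt |W|, is the inclusion of dom S into the
   completion of dom W, i.e. its values on dom S are the continuous extension
   of the inclusion of dom W. *)
Definition is_sqrt_embedding S (j : H -> K) : Prop :=
  linear_on (dom S) j /\ forall f, dom S f -> jnorm (j f) = hnorm (S f).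

Definition norm_continuous (U : K -> H) : Prop :=
  forall (k : K) (e : R), 0 < e -> exists2 r : R, 0 < r &
    forall h : K, jnorm (h - k) < r -> hnorm (U h - U k) < e.

Definition is_continuous_extension S (j : H -> K) (U : {linear K -> H}) : Prop :=
  norm_continuous U /\ forall f, dom S f -> U (j f) = S f.

(* The continuous extension U of S to K is a surjective isometry when W is
   self-adjoint with trivial kernel, hence inv_fun U is then its inverse. *)
Definition inv_fun (U : K -> H) : H -> K := 'pinv_(fun=> 0) [set: K] U.

End Operators.

Section SignedMeasures.
Context d (M : measurableType d) (R : realType).
Local Open Scope ereal_scope.

(* Unlike the charges of the library, a signed measure may take one of the two
   infinite values. *)
Record signedMeasure := SignedMeasure {
  smeas :> set M -> \bar R;
  smeas0 : smeas set0 = 0;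
  smeas_one_infinity :
    (forall A, measurable A -> smeas A != -oo) \/
    (forall A, measurable A -> smeas A != +oo);
  smeas_sigma_additive : semi_sigma_additive smeas }.

Variable nu : signedMeasure.

Definition tv_sums (A : set M) : set (\bar R) :=
  [set s | exists n (F : nat -> set M),
     [/\ (forall i, (i < n)%N -> measurable (F i) /\ F i `<=` A),
         trivIset `I_n F & s = \sum_(0 <= i < n) `|nu (F i)|]].

Definition abs_smeas (A : set M) : \bar R := ereal_sup (tv_sums A).

Let tv_sums_ub A n (F : nat -> set M) :
  (forall i, (i < n)%N -> measurable (F i) /\ F i `<=` A) ->
  trivIset `I_n F -> \sum_(0 <= i < n) `|nu (F i)| <= abs_smeas A.
Proof. by move=> FA tF; apply: ereal_sup_ubound; exists n, F. Qed.

Let tv_ge0 A : 0 <= abs_smeas A.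
Proof.
have := @tv_sums_ub A 0%N (fun=> set0).
by rewrite big_geq//; apply => // i j /=.
Qed.

Let tv0 : abs_smeas set0 = 0.
Proof.
apply/eqP; rewrite eq_le tv_ge0 andbT; apply: ge_ereal_sup => _ [n [F [FA _ ->]]].
rewrite big_nat big1// => i /andP[_ ilt].
have [_ Fi0] := FA _ ilt.
have -> : F i = set0 by apply/seteqP; split.
by rewrite smeas0 abse0.
Qed.

Let tv_le A B : A `<=` B -> abs_smeas A <= abs_smeas B.
Proof.
move=> AB; apply: ge_ereal_sup => _ [n [F [FA tF ->]]]; apply: tv_sums_ub => //.
by move=> i /FA[mF FiA]; split=> //; exact: subset_trans AB.
Qed.

Let tv_superadd A B : A `&` B = set0 ->
  abs_smeas A + abs_smeas B <= abs_smeas (A `|` B).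
Proof.
move=> AB0.
have key s t : tv_sums A s -> tv_sums B t -> s + t <= abs_smeas (A `|` B).
  move=> [n [F [FA tF ->]]] [m [G [GB tG ->]]].
  pose E i := if (i < n)%N then F i else G (i - n)%N.
  have -> : \sum_(0 <= i < n) `|nu (F i)| + \sum_(0 <= i < m) `|nu (G i)| =
            \sum_(0 <= i < n + m) `|nu (E i)|.
    rewrite [RHS](@big_cat_nat _ _ _ n)//= ?leq_addr//; congr (_ + _).
      by apply: eq_big_nat => i /andP[_ ilt]; rewrite /E ilt.
    apply: etrans (esym (big_addn 0%N (n + m)%N n xpredT _)); rewrite addKn.
    apply: eq_big_nat => i _.
    by rewrite /E ltnNge leq_addl /= addnK.
  apply: tv_sums_ub => [i ilt|i j /= ilt jlt].
    rewrite /E; case: ifPn => [/FA[mF FiA]|]; first by split=> // x /FiA; left.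
    rewrite -leqNgt => ni; have /GB[mG GiB] : (i - n < m)%N by rewrite ltn_subLR.
    by split=> // x /GiB; right.
  have GB' k : ~~ (k < n)%N -> (k < n + m)%N -> (k - n < m)%N.
    by rewrite -leqNgt => nk; rewrite ltn_subLR.
  rewrite /E; case: ifPn => in_; case: ifPn => jn [x [xi xj]].
  - by apply: tF => //; exists x.
  - have : (A `&` B) x.
      by split; [case: (FA _ in_) => _; apply|
        case: (GB _ (GB' _ jn jlt)) => _; apply].
    by rewrite AB0.
  - have : (A `&` B) x.
      by split; [case: (FA _ jn) => _; apply|
        case: (GB _ (GB' _ in_ ilt)) => _; apply].
    by rewrite AB0.
  - have : (i - n = j - n)%N.
      by apply: tG; [exact: GB'|exact: GB'|exists x].
    move: in_ jn; rewrite -!leqNgt => in_ jn eqij.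
    by rewrite -(subnK in_) -(subnK jn) eqij.
have sums_ge0 C s : tv_sums C s -> 0 <= s.
  by move=> [n [F [_ _ ->]]]; exact: sume_ge0.
have tvB_le t : tv_sums B t -> t <= abs_smeas (A `|` B).
  move=> Bt; apply: le_trans (tv_le _); last exact: subsetUr.
  exact: ereal_sup_ubound.
have key2 t : tv_sums B t -> abs_smeas A + t <= abs_smeas (A `|` B).
  move=> Bt; case: t Bt (sums_ge0 _ _ Bt) (tvB_le _ Bt) => [r| |]//= Bt _ tle.
    by rewrite -leeBrDr//; apply: ge_ereal_sup => s As; rewrite leeBrDr//; exact: key.
  by move: tle; rewrite leye_eq => /eqP ->; rewrite leey.
have := tv_le (@subsetUl _ A B); move: (tv_ge0 A) key2.
case: (abs_smeas A) => [r| |]//= _ key2.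
  by move=> _; rewrite -leeBrDl//; apply: ge_ereal_sup => t Bt; rewrite leeBrDl//; exact: key2.
by rewrite leye_eq => /eqP ->; rewrite leey.
Qed.

Let tv_sigma_additive : semi_sigma_additive abs_smeas.
Proof.
move=> A mA tA mUA.
have cv : cvgn (fun n => \sum_(0 <= k < n) abs_smeas (A k)).
  by apply: is_cvg_nneseries => n _ _; exact: tv_ge0.
rewrite -[X in _ --> X](_ : \sum_(0 <= k <oo) abs_smeas (A k) = _) //.
apply/eqP; rewrite eq_le; apply/andP; split.
  apply: lime_le => //; apply: nearW => n.
  apply: (@le_trans _ _ (abs_smeas (\big[setU/set0]_(k < n) A k))); last first.
    by apply: tv_le; exact: bigsetU_bigcup.
  elim: n => [|n IHn]; first by rewrite big_geq// tv_ge0.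
  rewrite big_nat_recr//= big_ord_recr/=; apply: le_trans (tv_superadd _).
    by rewrite leeD2r.
  apply/seteqP; split=> // x [].
  rewrite -bigcup_mkord => -[k /= kn Akx] Anx.
  have kn' : k = n by apply: tA => //; exists x.
  by move: kn; rewrite kn' ltnn.
apply: ge_ereal_sup => _ [n [F [FA tF ->]]].
have le1 i : (i < n)%N ->
    `|nu (F i)| <= \sum_(0 <= k <oo) `|nu (F i `&` A k)|.
  move=> ilt; have [mF FiA] := FA _ ilt.
  have FE : F i = \bigcup_k (F i `&` A k).
    by rewrite -setI_bigcupr; apply/esym/setIidPl.
  have mFA k : measurable (F i `&` A k) by exact: measurableI.
  have tFA : trivIset setT (fun k => F i `&` A k) by exact: trivIset_setIl.
  have := @smeas_sigma_additive nu _ mFA tFA.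
  rewrite -FE => /(_ mF) /cvg_abse cvF.
  rewrite -(cvg_lim _ cvF)//; apply: lime_le; first by apply/cvg_ex; eexists; exact: cvF.
  apply: nearW => m /=; apply: le_trans (lee_abs_sum _ _ _) _.
  exact: nneseries_lim_ge.
apply: (@le_trans _ _ (\sum_(0 <= i < n) \sum_(0 <= k <oo) `|nu (F i `&` A k)|)).
  by rewrite big_nat [leRHS]big_nat; apply: lee_sum => i /andP[_]; exact: le1.
rewrite -nneseries_sum_nat//.
apply: lee_nneseries => [k _|k _]; first by rewrite sume_ge0.
apply: tv_sums_ub => [i /FA[mF FiA]|].
  by split; [exact: measurableI|exact: subIsetr].
by move=> i j ilt jlt [x [[xi _] [xj _]]]; apply: tF => //; exists x.
Qed.

HB.instance Definition _ := isMeasure.Build _ _ _ abs_smeas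
  tv0 tv_ge0 tv_sigma_additive.

End SignedMeasures.

Section Frames.
Context d (M : measurableType d) (R : realType).

Definition weakly_measurable (V : lmodType R[i]) (b : V -> V -> R[i])
    (eta : M -> V) : Prop :=
  forall k, measurable_fun setT (fun x => complex.Re (b (eta x) k)) /\
            measurable_fun setT (fun x => complex.Im (b (eta x) k)).

Definition frame_for (V : lmodType R[i]) (b : V -> V -> R[i]) (nrm : V -> R)
    (nu : signedMeasure M R) (n : nat) (eta : 'I_n -> M -> V) (lo up : R) : Prop :=
  [/\ 0 < lo <= up,
      (forall x, lin_indep (eta ^~ x)),
      (forall i, weakly_measurable b (eta i)) &
      (forall k : V,
         let s := (\sum_(i < n) \int[abs_smeas nu]_x
                     (Normc.normc (b (eta i x) k) ^+ 2)%:E)%E in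
         ((lo * nrm k ^+ 2)%:E <= s)%E /\ (s <= (up * nrm k ^+ 2)%:E)%E)].

Definition hilbert_frame (H : hilbertSpace R) :=
  frame_for (@hip R H) (@hnorm R H).

Definition krein_frame (K : kreinSpace R) :=
  frame_for (@kform R K) (@jnorm R K).

End Frames.

(* Main.v *)
Require Import Defs.
From mathcomp Require Import all_boot all_order all_algebra.
From mathcomp Require Import all_classical all_reals all_analysis.
From mathcomp Require Import complex.
From mathcomp Require Import ring lra.

Set Implicit Arguments.
Unset Strict Implicit.
Unset Printing Implicit Defensive.

Import Order.TTheory GRing.Theory Num.Theory.
Import numFieldNormedType.Exports.

Local Open Scope classical_set_scope.
Local Open Scope ring_scope.

(** Both parts rest on [U] being a unitary map between two Hilbert spaces: the
    space [K], with the inner product [jip] of its fundamental symmetry [F], and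
    [H].

    The inner product [jip] is the orthogonal sum of [kform] on [kpos] and of
    [- kform] on [kneg], so it is positive definite and complete
    ([jip_hilbert]).  On the image of [dom S], hence on the dense image of
    [dom W], the norms of [k] and [U k] agree by hypothesis; both depend
    continuously on [k], so they agree everywhere ([extension_isometric]), and
    polarization makes [U] preserve inner products ([extension_unitary]).

    The range of [U] is then complete, and by the projection theorem it is all
    of [H] as soon as its orthogonal complement vanishes.  A vector orthogonal
    to it is orthogonal to the range of [S], so it lies in the kernel of the
    self-adjoint operator [S] ([ran_orthogonal_ker]); this is contained in the
    kernel of [absW], hence in that of [W = J absW], which is trivial.

    For the frames, [kform (U^-1 y) k = jip (U^-1 y) (F k) = <y, U (F k)>], and
    [k |-> U (F k)] is a norm-preserving bijection from [K] to [H].  So each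
    frame condition tested at [k] on the Krein side is literally the condition
    tested at [U (F k)] on the Hilbert side.  Finally,
    [U (j (S^-1 y)) = S (S^-1 y) = y] for [y] in the range of [S], which is the
    second part. *)

Local Notation Re := complex.Re.
Local Notation Im := complex.Im.

Lemma complex_eqP (R : realType) (x y : R[i]) :
  Re x = Re y -> Im x = Im y -> x = y.
Proof. by case: x y => [a b] [c d] /= -> ->. Qed.

(** * Hermitian forms and their norms *)

Section HermitianForms.
Variables (R : realType) (V : lmodType R[i]) (b : V -> V -> R[i]).
Hypothesis herm : hermitian_form b.
Implicit Types (f g h : V) (t : R).

Local Notation sq f := (Re (b f f)).

Lemma formDr f g h : b f (g + h) = b f g + b f h.
Proof. by have := herm.1 1 f g h; rewrite scale1r mul1r. Qed.

Lemma form0r f : b f 0 = 0.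
Proof. by apply: (@addrI _ (b f 0)); rewrite -formDr !addr0. Qed.

Lemma formZr (a : R[i]) f g : b f (a *: g) = a * b f g.
Proof. by have := herm.1 a f g 0; rewrite !addr0 form0r addr0. Qed.

Lemma formNr f g : b f (- g) = - b f g.
Proof. by rewrite -scaleN1r formZr mulN1r. Qed.

Lemma formBr f g h : b f (g - h) = b f g - b f h.
Proof. by rewrite formDr formNr. Qed.

Lemma form_eq0C f g : b f g = 0 -> b g f = 0.
Proof. by rewrite [b g f]herm.2 => ->; rewrite conjc0. Qed.

Lemma Re_formC f g : Re (b f g) = Re (b g f).
Proof. by rewrite [b f g]herm.2; case: (b g f). Qed.

Lemma Re_formDr f g h : Re (b f (g + h)) = Re (b f g) + Re (b f h).
Proof. by rewrite formDr; case: (b f g) (b f h) => [? ?] []. Qed.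

Lemma Re_formZr t f g : Re (b f (t%:C%C *: g)) = t * Re (b f g).
Proof. by rewrite formZr; case: (b f g) => u v /=; rewrite mul0r subr0. Qed.

(** Multiplication by the imaginary unit turns statements about all real parts
    of a form into statements about its imaginary parts. *)
Lemma Re_formir f g : Re (b f ('i%C *: g)) = - Im (b f g).
Proof. by rewrite formZr; case: (b f g) => u v /=; rewrite mul0r mul1r sub0r. Qed.

Lemma sqD f g : sq (f + g) = sq f + 2 * Re (b f g) + sq g.
Proof.
rewrite Re_formDr (Re_formC _ f) (Re_formC _ g) !Re_formDr (Re_formC g f).
ring.
Qed.

Lemma sqZ t f : sq (t%:C%C *: f) = t ^+ 2 * sq f.
Proof. by rewrite Re_formZr Re_formC Re_formZr mulrA expr2. Qed.

Lemma sqN f : sq (- f) = sq f.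
Proof. by rewrite formNr raddfN /= Re_formC formNr raddfN opprK. Qed.

Lemma sqB f g : sq (f - g) = sq f - 2 * Re (b f g) + sq g.
Proof. by rewrite sqD sqN formNr raddfN /=; ring. Qed.

Lemma form_normN f : form_norm b (- f) = form_norm b f.
Proof. by rewrite /form_norm sqN. Qed.

Lemma form_normBC f g : form_norm b (f - g) = form_norm b (g - f).
Proof. by rewrite -form_normN opprB. Qed.

Hypothesis pos : forall f, f != 0 -> 0 < b f f.

Lemma sq_ge0 f : 0 <= sq f.
Proof.
have [->|/pos] := eqVneq f 0; first by rewrite form0r.
by rewrite ltcE => /andP[_ /ltW].
Qed.

Lemma sq_eq0 f : sq f = 0 -> f = 0.
Proof.
move=> f0; apply/eqP/negP => /negP /pos.
by rewrite ltcE f0 ltxx andbF.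
Qed.

Lemma sqr_form_norm f : form_norm b f ^+ 2 = sq f.
Proof. by rewrite sqr_sqrtr // sq_ge0. Qed.

Lemma form_norm_ge0 f : 0 <= form_norm b f.
Proof. exact: sqrtr_ge0. Qed.

Lemma form_norm_lt f e : 0 < e -> (form_norm b f < e) = (sq f < e ^+ 2).
Proof.
by move=> e0; rewrite -sqr_form_norm ltr_pXn2r ?nnegrE ?form_norm_ge0 ?ltW.
Qed.

(** The square of [t f - s g], with [s] and [t] the norms of [f] and [g], equals
    [2 s t (s t - Re (b f g))] and is nonnegative. *)
Lemma Cauchy_Schwarz f g : Re (b f g) <= form_norm b f * form_norm b g.
Proof.
set s := form_norm b f; set t := form_norm b g.
have s0 : 0 <= s := form_norm_ge0 f.
have t0 : 0 <= t := form_norm_ge0 g.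
have [s00|sN0] := eqVneq s 0.
  have -> : f = 0 by apply: sq_eq0; rewrite -sqr_form_norm -/s s00 expr0n.
  by rewrite Re_formC form0r mulr_ge0.
have [t00|tN0] := eqVneq t 0.
  have -> : g = 0 by apply: sq_eq0; rewrite -sqr_form_norm -/t t00 expr0n.
  by rewrite form0r mulr_ge0.
have st0 : 0 < s * t by rewrite mulr_gt0 // lt0r ?sN0 ?tN0.
have := sq_ge0 (t%:C%C *: f - s%:C%C *: g).
rewrite sqB !sqZ -!sqr_form_norm Re_formZr Re_formC Re_formZr Re_formC -/s -/t.
set r := Re _ => h.
rewrite -subr_ge0 -(pmulr_rge0 _ st0); nra.
Qed.

Lemma form_norm_triangle f g :
  form_norm b (f + g) <= form_norm b f + form_norm b g.
Proof.
rewrite -(@ler_pXn2r _ 2) ?nnegrE ?addr_ge0 ?form_norm_ge0 //.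
rewrite sqr_form_norm sqD -!sqr_form_norm.
have := Cauchy_Schwarz f g; nra.
Qed.

Lemma form_norm_dist f g :
  `|form_norm b f - form_norm b g| <= form_norm b (f - g).
Proof.
rewrite ler_norml lerBlDr.
have := form_norm_triangle (f - g) g; rewrite subrK => ->.
have := form_norm_triangle (g - f) f; rewrite subrK form_normBC => ?.
by rewrite andbT; lra.
Qed.

(** By Pythagoras, a vector orthogonal to [h] is no closer to [h] than [0] is, so
    [D] can come close to [h] only if [h] is null. *)
Lemma dense_orthogonal (D : set V) h :
  dense_for b D -> (forall f, D f -> b f h = 0) -> h = 0.
Proof.
move=> dD hD; apply: sq_eq0; apply/eqP; rewrite eq_le sq_ge0 andbT leNgt.
apply/negP => h0.
have e0 : 0 < form_norm b h by rewrite sqrtr_gt0.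
have [f Df] := dD h _ e0; rewrite form_norm_lt // sqr_form_norm sqB.
rewrite (Re_formC h) (hD f) // mulr0 subr0 => fh; have := sq_ge0 f; lra.
Qed.

End HermitianForms.

Section Convergence.
Variables (R : realType) (V : lmodType R[i]) (b : V -> V -> R[i]).

Lemma natSinv_lt (e : R) : 0 < e ->
  exists N : nat, forall n, (N <= n)%N -> n.+1%:R^-1 < e.
Proof.
by move=> e0; have [N _ NP] := near_infty_natSinv_lt (PosNum e0); exists N.
Qed.

Lemma form_cvgP (u : nat -> V) (f : V) : form_cvg b u f <->
  forall e : R, 0 < e ->
    exists N : nat, forall n, (N <= n)%N -> form_norm b (u n - f) < e.
Proof.
have absE n : `|0 - form_norm b (u n - f)| = form_norm b (u n - f).
  by rewrite sub0r normrN ger0_norm ?sqrtr_ge0.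
split=> [/cvgrPdist_lt uf e /uf[N _ NP]|uf].
  by exists N => n /NP /=; rewrite absE.
apply/cvgrPdist_lt => e /uf[N NP].
by exists N => // n /NP /=; rewrite absE.
Qed.

End Convergence.

(** * Orthogonal projection onto a complete subspace *)

Section Projection.
Variables (R : realType) (V : lmodType R[i]) (b : V -> V -> R[i]).
Hypothesis herm : hermitian_form b.
Hypothesis pos : forall f, f != 0 -> 0 < b f f.
Variable D : set V.
Hypothesis hD : hilbert_on b D.

Local Notation sq f := (Re (b f f)).

(** A minimizing sequence is Cauchy by the parallelogram identity, because the
    midpoint of two of its terms is still at distance at least the infimum
    from [y]. *)
Lemma nearest_point y :
  exists2 z, D z & forall w, D w -> sq (y - z) <= sq (y - w).
Proof.
have [[D0 Dlin] _ Dcomp] := hD.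
pose A := [set sq (y - w) | w in D].
have Alb : has_lbound A by exists 0 => _ [w _ <-]; exact: sq_ge0.
have Ainf : has_inf A by split=> //; exists (sq (y - 0)), 0.
have A_le w : D w -> inf A <= sq (y - w) by move=> Dw; apply: (ge_inf Alb); exists w.
have /choice[z zP] (n : nat) :
    exists z, D z /\ sq (y - z) < inf A + n.+1%:R^-1.
  have [|_ [z Dz <-] ?] := inf_adherent _ Ainf (eps := n.+1%:R^-1).
    by rewrite invr_gt0.
  by exists z.
have zC : form_cauchy b z.
  move=> e e0; have [|N NP] := @natSinv_lt R (e ^+ 2 / 4).
    by rewrite divr_gt0 ?exprn_gt0.
  exists N => m n /NP Nm /NP Nn; rewrite form_norm_lt //.
  have [Dm zm] := zP m; have [Dn zn] := zP n.
  (* [c] is the vector from that midpoint to [y]. *)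
  pose c := ((1 / 2 : R)%:C)%C *: ((y - z m) + (y - z n)).
  have cE : c = y - ((1 / 2 : R)%:C)%C *: (z m + z n).
    rewrite /c addrACA -opprD scalerBr; congr (_ - _).
    rewrite scalerDr -scalerDl -rmorphD /= (_ : _ + _ = 1) ?scale1r //; lra.
  have -> : z m - z n = (y - z n) - (y - z m).
    by rewrite opprB [RHS]addrC addrA subrK.
  rewrite sqB // (Re_formC herm (y - z n)).
  have := A_le (((1 / 2 : R)%:C)%C *: (z m + z n)).
  rewrite -cE /c sqZ // sqD // => mid.
  suff /mid : D (((1 / 2 : R)%:C)%C *: (z m + z n)).
    move: zm zn Nm Nn; move: (m.+1%:R^-1) (n.+1%:R^-1) => u v.
    by move=> ? ? ? ? ?; lra.
  rewrite -[X in D X]addr0; apply: (Dlin) => //.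
  by rewrite -[z m]scale1r; exact: Dlin.
have [x Dx /form_cvgP zx] := Dcomp z (fun n => (zP n).1) zC.
exists x => // w Dw.
rewrite -!sqr_form_norm // ler_pXn2r ?nnegrE ?form_norm_ge0 //.
apply/ler_addgt0Pr => e e0.
have e20 : 0 < e / 2 by lra.
have [N1 N1P] := zx _ e20.
have [|N2 N2P] := @natSinv_lt R ((e / 2) ^+ 2); first by rewrite exprn_gt0.
pose n := maxn N1 N2.
have n1 := N1P n (leq_maxl _ _); have n2 := N2P n (leq_maxr _ _).
have yzn : form_norm b (y - z n) <= form_norm b (y - w) + e / 2.
  have w0 := form_norm_ge0 b (y - w).
  rewrite -(@ler_pXn2r _ 2) ?nnegrE ?addr_ge0 ?form_norm_ge0 ?(ltW e20) //.
  have := (zP n).2; have := A_le w Dw.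
  rewrite -!sqr_form_norm //; move: n2; move: (n.+1%:R^-1) => v v2 Aw zn.
  have := mulr_ge0 w0 (ltW e20); rewrite sqrrD -mulr_natr; lra.
have := form_norm_triangle herm pos (y - z n) (z n - x).
rewrite addrA subrK; lra.
Qed.

(** First variation at the nearest point [z]: [t |-> sq (y - z - t v)] is least
    at [0].  Complex multiples of [v] then give the imaginary part. *)
Lemma projection y : exists2 z, D z & forall v, D v -> b v (y - z) = 0.
Proof.
have [[D0 Dlin] _ _] := hD.
have [z Dz zmin] := nearest_point y; exists z => //.
have Re0 v : D v -> Re (b (y - z) v) = 0.
  move=> Dv; set r := Re _.
  have quad (t : R) : 0 <= - (2 * t * r) + t ^+ 2 * sq v.
    have /zmin : D (t%:C%C *: v + z) by exact: Dlin.
    rewrite [_ *: _ + z]addrC opprD addrA [X in _ <= X]sqB // sqZ //.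
    by rewrite Re_formZr // -/r; lra.
  (* The minimizer of the quadratic is [r / sq v]; the added [1] avoids a case
     distinction on [v = 0]. *)
  have := quad (r / (sq v + 1)).
  have q0 : 0 < sq v + 1 by have := sq_ge0 herm pos v; lra.
  rewrite -(pmulr_rge0 _ (exprn_gt0 2 q0)).
  have -> : (sq v + 1) ^+ 2 * (- (2 * (r / (sq v + 1)) * r) +
     (r / (sq v + 1)) ^+ 2 * sq v) = - r ^+ 2 * (sq v + 2).
    by field; rewrite gt_eqF.
  rewrite mulNr oppr_ge0 pmulr_lle0; last by have := sq_ge0 herm pos v; lra.
  by move=> r0; apply/eqP; rewrite -sqrf_eq0 eq_le r0 sqr_ge0.
move=> v Dv; apply: form_eq0C => //; apply: complex_eqP; first exact: Re0.
apply/oppr_inj; rewrite -Re_formir // Re0 ?oppr0 //.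
by rewrite -[_ *: _]addr0; exact: Dlin.
Qed.

Lemma orthocomplement0_full :
  (forall w, (forall v, D v -> b v w = 0) -> w = 0) -> D = setT.
Proof.
move=> ortho; apply/seteqP; split=> // y _.
have [z Dz /ortho /eqP] := projection y.
by rewrite subr_eq0 => /eqP ->.
Qed.

End Projection.

(** * The Hilbert space structure of a Krein space *)

Section KreinHilbert.
Variables (R : realType) (K : kreinSpace R).
Implicit Types (h k p m : K).

Lemma kpos_lin (a : R[i]) f g : @kpos R K f -> kpos g -> kpos (a *: f + g).
Proof. by have [[_ pD] _ _] := kpos_hilbert K; exact: pD. Qed.

Lemma kneg_lin (a : R[i]) f g : @kneg R K f -> kneg g -> kneg (a *: f + g).
Proof. by have [[_ pD] _ _] := kneg_hilbert K; exact: pD. Qed.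

Lemma kposB f g : @kpos R K f -> kpos g -> kpos (f - g).
Proof. by rewrite -scaleN1r addrC => pf pg; exact: kpos_lin. Qed.

Lemma knegB f g : @kneg R K f -> kneg g -> kneg (f - g).
Proof. by rewrite -scaleN1r addrC => pf pg; exact: kneg_lin. Qed.

Lemma knegN f : @kneg R K f -> kneg (- f).
Proof.
have [[n0 _] _ _] := kneg_hilbert K.
by rewrite -sub0r => nf; exact: knegB.
Qed.

Lemma fund_sym_lin (a : R[i]) h k :
  fund_sym (a *: h + k) = a *: fund_sym h + fund_sym k.
Proof.
have [p [m [pp mm ->]]] := kdecomp h; have [q [n [qq nn ->]]] := kdecomp k.
rewrite scalerDr addrACA !fund_symE //; [|exact: kpos_lin|exact: kneg_lin].
by rewrite opprD addrACA scalerBr.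
Qed.

Lemma fund_symK : involutive (@fund_sym R K).
Proof.
move=> k; have [p [m [pp mm ->]]] := kdecomp k.
by rewrite fund_symE // fund_symE ?opprK //; exact: knegN.
Qed.

Lemma kform_jip h k : kform h k = jip h (fund_sym k).
Proof. by rewrite /jip fund_symK. Qed.

Lemma jipE p m q n : @kpos R K p -> kneg m -> kpos q -> kneg n ->
  jip (p + m) (q + n) = kform p q - kform m n.
Proof.
move=> pp mm qq nn; have hm := kform_hermitian K.
rewrite /jip fund_symE // formBr // ![kform (p + m) _]hm.2 !formDr //.
rewrite (korth qq mm) addr0 (form_eq0C hm (korth pp nn)) add0r.
by rewrite -!hm.2.
Qed.

Lemma jip_hermitian : hermitian_form (@jip R K).
Proof.
have hm := kform_hermitian K; split=> [a f g h|f g].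
  by rewrite /jip fund_sym_lin hm.1.
have [p [m [pp mm ->]]] := kdecomp f; have [q [n [qq nn ->]]] := kdecomp g.
by rewrite !jipE // hm.2 [kform n m]hm.2 rmorphB.
Qed.

Lemma jip_diag p m : @kpos R K p -> kneg m ->
  Re (jip (p + m) (p + m)) = Re (kform p p) + Re (- kform m m).
Proof. by move=> pp mm; rewrite jipE // raddfD. Qed.

Lemma kpos_ge0 p : kpos p -> 0 <= kform p p.
Proof.
have [_ ppos _] := kpos_hilbert K.
have [->|pN0 /ppos/(_ pN0)/ltW//] := eqVneq p 0.
by rewrite (form0r (kform_hermitian K)).
Qed.

Lemma kneg_ge0 m : kneg m -> 0 <= - kform m m.
Proof.
have [_ npos _] := kneg_hilbert K.
have [->|mN0 /npos/(_ mN0)/ltW//] := eqVneq m 0.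
by rewrite (form0r (kform_hermitian K)) oppr0.
Qed.

Lemma jip_pos k : k != 0 -> 0 < jip k k.
Proof.
have [_ ppos _] := kpos_hilbert K; have [_ npos _] := kneg_hilbert K.
have [p [m [pp mm ->]]] := kdecomp k => k0.
rewrite jipE //; have [p0|/ppos p0] := eqVneq p 0.
  by rewrite ltr_wpDl ?kpos_ge0 // npos //; move: k0; rewrite p0 add0r.
by rewrite ltr_pwDl ?kneg_ge0 // p0.
Qed.

(** The square of the norm splits over [kpos] and [kneg], so the components of
    a Cauchy sequence are Cauchy and converge separately. *)
Lemma jip_hilbert : hilbert_on (@jip R K) setT.
Proof.
split=> [//|f _|u _ uC]; first exact: jip_pos.
have [_ _ pcomp] := kpos_hilbert K; have [_ _ ncomp] := kneg_hilbert K.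
have [p pP] := choice (fun n => kdecomp (u n)).
have [m mP] := choice pP.
have pp n : kpos (p n) by case: (mP n).
have mm n : kneg (m n) by case: (mP n).
have uE n : u n = p n + m n by case: (mP n).
have Re_ge0 (z : R[i]) : 0 <= z -> 0 <= Re z by rewrite lecE => /andP[].
have pB (x y : K) : kpos x -> kpos y -> 0 <= Re (kform (x - y) (x - y)).
  by move=> px py; apply: Re_ge0; apply: kpos_ge0; exact: kposB.
have nB (x y : K) : kneg x -> kneg y -> 0 <= Re (- kform (x - y) (x - y)).
  by move=> px py; apply: Re_ge0; apply: kneg_ge0; exact: knegB.
have uBE (x y x' y' : K) : kpos x -> kneg y -> kpos x' -> kneg y' ->
    Re (jip (x + y - (x' + y')) (x + y - (x' + y'))) =
    Re (kform (x - x') (x - x')) + Re (- kform (y - y') (y - y')).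
  by move=> ? ? ? ?; rewrite opprD addrACA jip_diag //; [exact: kposB|exact: knegB].
have [e /uC[N NP]|x px /form_cvgP xcvg] := pcomp p pp.
- exists N => i j Ni Nj; apply: le_lt_trans (NP i j Ni Nj).
  by rewrite ler_wsqrtr // !uE uBE // lerDl nB.
have [e /uC[N NP]|y ny /form_cvgP ycvg] := ncomp m mm.
- exists N => i j Ni Nj; apply: le_lt_trans (NP i j Ni Nj).
  by rewrite ler_wsqrtr // !uE uBE // lerDr pB.
exists (x + y) => //; apply/form_cvgP => e e0.
have e20 : 0 < e / 2 by lra.
have [N1 N1P] := xcvg _ e20; have [N2 N2P] := ycvg _ e20.
exists (maxn N1 N2) => n; rewrite geq_max => /andP[/N1P n1 /N2P n2].
rewrite (form_norm_lt jip_hermitian jip_pos) // uE uBE //.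
move: n1 n2; rewrite /form_norm.
rewrite -{2}(sqr_sqrtr (pB _ _ (pp n) px)) -{2}(sqr_sqrtr (nB _ _ (mm n) ny)).
have := sqrtr_ge0 (Re (kform (p n - x) (p n - x))).
have := sqrtr_ge0 (Re (- kform (m n - y) (m n - y))).
nra.
Qed.

Lemma jnorm_fund_sym k : jnorm (fund_sym k) = jnorm k.
Proof.
rewrite /jnorm /form_norm; congr Num.sqrt.
by rewrite /jip fund_symK (Re_formC (kform_hermitian K)).
Qed.

End KreinHilbert.

(** * Self-adjoint operators *)

Section SelfAdjoint.
Variables (R : realType) (H : hilbertSpace R).
Implicit Types (W absW S : operator H).

Lemma hip_pos (f : H) : f != 0 -> 0 < hip f f.
Proof. by have [_ + _] := hip_hilbert H; exact. Qed.

Lemma linear_on0 (V X : lmodType R[i]) (D : set V) (T : V -> X) :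
  linear_on D T -> T 0 = 0.
Proof.
move=> [[D0 _] /(_ 1 0 0 D0 D0)]; rewrite !scale1r addr0 => T0.
by apply: (@addrI _ (T 0)); rewrite addr0 -T0.
Qed.

(** A vector [w] orthogonal to the range has [0] as a value of the adjoint, so
    it lies in the domain of the adjoint, which is [S]; density of [dom S]
    identifies that value with [S w]. *)
Lemma ran_orthogonal_ker S (w : H) : self_adjoint S ->
  (forall f, dom S f -> hip (S f) w = 0) -> dom S w /\ S w = 0.
Proof.
move=> [linS dS [domS ES]] wS.
have adj0 : adjoint_at S w 0.
  by move=> f Sf; rewrite wS // (form0r (hip_hermitian H)).
have Sw : dom S w by rewrite -domS; exists 0.
split=> //; apply: (dense_orthogonal (hip_hermitian H) hip_pos dS) => f Sf.
rewrite -(ES w); last by rewrite domS.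
rewrite /adjoint /=; case: xgetP => [h _ hP|/(_ 0)//].
by rewrite -hP // wS.
Qed.

Lemma dom_polarP W absW S (J : {linear H -> H}) f :
  is_polar W J absW -> is_positive_sqrt S absW ->
  dom W f <-> dom S f /\ dom S (S f).
Proof. by move=> [_ _ _ [-> _]] [_ _ [<- _]]. Qed.

Lemma ker_sqrt_abs W absW S (J : {linear H -> H}) f :
  is_polar W J absW -> is_positive_sqrt S absW ->
  dom S f -> S f = 0 -> dom W f /\ W f = 0.
Proof.
move=> polW sqrtS Sf Sf0.
have [[linS _ _] _ [_ SE]] := sqrtS; have [_ _ _ [_ WE]] := polW.
have SSf : dom (op_comp S S) f by split=> //=; rewrite Sf0; case: linS => -[].
have Wf : dom W f by apply/(dom_polarP f polW sqrtS).
split=> //; rewrite WE //= -SE //= Sf0 (linear_on0 linS) //.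
exact: linear0.
Qed.

End SelfAdjoint.

(** * The continuous extension of the square root of |W| *)

Section Unitary.
Variables (R : realType) (H : hilbertSpace R) (W absW S : operator H).
Variables (J : {linear H -> H}) (K : kreinSpace R) (j : H -> K).
Variable U : {linear K -> H}.
Hypothesis polW : is_polar W J absW.
Hypothesis sqrtS : is_positive_sqrt S absW.
Hypothesis HW : is_HW W J j.
Hypothesis embS : is_sqrt_embedding S j.
Hypothesis extU : is_continuous_extension S j U.

Let hh := hip_hermitian H.
Let jh := jip_hermitian K.
Let hpos := @hip_pos R H.

(** Both norms are continuous in [k], and they agree on the image of [dom W],
    which is contained in [dom S] and dense in [K]. *)
Lemma extension_isometric k : hnorm (U k) = jnorm k.
Proof.
have [_ _ _ dW] := HW; have [_ jS] := embS; have [cU US] := extU.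
apply/eqP; rewrite -subr_eq0 -normr_eq0 eq_le normr_ge0 andbT.
apply/ler_addgt0Pr => e e0; rewrite add0r.
have e20 : 0 < e / 2 by lra.
have [r r0 rU] := cU k _ e20.
have m0 : 0 < Num.min r (e / 2) by rewrite lt_min r0.
have [_ [f Wf <-]] := dW k _ m0.
have [Sf _] := (dom_polarP f polW sqrtS).1 Wf.
rewrite lt_min => /andP[kr ke].
have /rU : jnorm (j f - k) < r by rewrite /jnorm form_normBC.
rewrite US // => UU.
have := form_norm_dist jh (@jip_pos R K) k (j f).
have := form_norm_dist hh hpos (S f) (U k).
rewrite -!/(hnorm _) -!/(jnorm _) jS //.
move: kr ke UU; rewrite -!/(hnorm _) -!/(jnorm _) => kr ke UU d1 d2.
have := ler_normD (hnorm (U k) - hnorm (S f)) (hnorm (S f) - jnorm k).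
rewrite addrA subrK => h; apply: (le_trans h).
rewrite [X in _ <= X]splitr; apply: lerD.
  by rewrite distrC (le_trans d1) // ltW.
by rewrite distrC (le_trans d2) // ltW.
Qed.

Lemma extension_sq k : Re (hip (U k) (U k)) = Re (jip k k).
Proof.
rewrite -(sqr_form_norm hh hpos) -(sqr_form_norm jh (@jip_pos R K)).
by rewrite -/(hnorm _) extension_isometric.
Qed.

Lemma extension_unitary h k : hip (U h) (U k) = jip h k.
Proof.
have ReE x y : Re (hip (U x) (U y)) = Re (jip x y).
  have := extension_sq (x + y); rewrite linearD (sqD hh) (sqD jh).
  by rewrite !extension_sq; lra.
apply: complex_eqP => //; apply: oppr_inj.
by rewrite -(Re_formir hh) -(Re_formir jh) -linearZ ReE.
Qed.

Lemma extension_inj : injective U.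
Proof.
move=> h k hk; apply/eqP; rewrite -subr_eq0; apply/eqP.
apply: (sq_eq0 (@jip_pos R K)); rewrite -extension_sq linearB hk subrr.
by rewrite (form0r hh).
Qed.

Lemma extension_range_hilbert : hilbert_on (@hip R H) (range U).
Proof.
split.
- split; first by exists 0; rewrite ?linear0.
  by move=> a _ _ [h _ <-] [k _ <-]; exists (a *: h + k); rewrite ?linearP.
- by move=> f _; exact: hpos.
- move=> u uR uC; have /choice[k UkE] n : exists x, U x = u n.
    by have [x _ xu] := uR n; exists x.
  have [_ _ /(_ k (fun=> I))[|x _ kx]] := jip_hilbert K.
    move=> e /uC[N NP]; exists N => m n Nm Nn.
    have := NP m n Nm Nn.
    by rewrite -!UkE -linearB -/(hnorm _) extension_isometric.
  exists (U x); first by exists x.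
  apply/form_cvgP => e e0; move/form_cvgP: kx => /(_ e e0)[N NP].
  exists N => n /NP.
  by rewrite -UkE -linearB -/(hnorm _) extension_isometric.
Qed.

Hypothesis kerW : forall f, dom W f -> W f = 0 -> f = 0.

(** The range of [U] contains that of [S], whose orthogonal complement is the
    kernel of [S], a part of the kernel of [W]. *)
Lemma extension_surj : range U = setT.
Proof.
have [selfS _ _] := sqrtS; have [_ US] := extU.
apply: (orthocomplement0_full hh hpos extension_range_hilbert) => w wU.
have [f Sf|Sw Sw0] := ran_orthogonal_ker selfS (w := w).
  by apply: wU; exists (j f) => //; exact: US.
by have [] := ker_sqrt_abs polW sqrtS Sw Sw0; exact: kerW.
Qed.

Lemma inv_funK y : U (inv_fun U y) = y.
Proof. by rewrite /inv_fun pinvK // inE extension_surj. Qed.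

Lemma inv_fun_sqrt y : dom (op_inv S) y -> inv_fun U y = j (op_inv S y).
Proof.
move=> [f Sf Sfy]; have [_ US] := extU; apply: extension_inj.
have yS : (S @` dom S) y by exists f.
rewrite inv_funK US /=; first by rewrite pinvK ?inE.
apply: (surjpinv_image_sub (B := S @` dom S)); last by exists y.
by move=> x.
Qed.

(** * Transport of continuous frames *)

Lemma kform_inv_fun y k : kform (inv_fun U y) k = hip y (U (fund_sym k)).
Proof. by rewrite kform_jip -extension_unitary inv_funK. Qed.

(** [kform_inv_fun] matches the tests of the two frames along the bijection
    [k |-> U (fund_sym k)], which preserves the norms. *)
Lemma frame_inv_fun d (M : measurableType d) (nu : signedMeasure M R) n
    (eta : 'I_n -> M -> H) (a b : R) :
  hilbert_frame nu eta a b <->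
  krein_frame nu (fun i x => inv_fun U (eta i x)) a b.
Proof.
have normE k : hnorm (U (fund_sym k)) = jnorm k.
  by rewrite extension_isometric jnorm_fund_sym.
have funE h : exists k, h = U (fund_sym k).
  by exists (fund_sym (inv_fun U h)); rewrite fund_symK inv_funK.
have inv_sum x (c : 'I_n -> R[i]) :
    U (\sum_(i < n) c i *: inv_fun U (eta i x)) = \sum_(i < n) c i *: eta i x.
  by rewrite linear_sum; apply: eq_bigr => i _; rewrite linearZ /= inv_funK.
split=> -[ab indep meas bound]; split=> //.
- move=> x c c0; apply: (indep x); rewrite -inv_sum c0; exact: linear0.
- move=> i k; have := meas i (U (fund_sym k)).
  under eq_fun do rewrite -kform_inv_fun.
  by under [X in _ /\ measurable_fun _ X]eq_fun do rewrite -kform_inv_fun.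
- move=> k /=; have := bound (U (fund_sym k)); rewrite /= normE.
  under eq_bigr do under eq_integral do rewrite -kform_inv_fun.
  by [].
- move=> x c c0; apply: (indep x); apply: extension_inj.
  by rewrite inv_sum c0 linear0.
- move=> i h; have [k ->] := funE h; have := meas i k.
  under eq_fun do rewrite kform_inv_fun.
  by under [X in _ /\ measurable_fun _ X]eq_fun do rewrite kform_inv_fun.
- move=> h /=; have [k ->] := funE h; have := bound k; rewrite /= normE.
  under eq_bigr do under eq_integral do rewrite kform_inv_fun.
  by [].
Qed.

End Unitary.

Theorem corollary4p2 (R : realType) (H : hilbertSpace R)
  (W absW S : operator H) (J : {linear H -> H})
  (K : kreinSpace R) (j : H -> K) (U : {linear K -> H})
  (d : measure_display) (M : measurableType d) (nu : signedMeasure M R) :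
  self_adjoint W ->
  (forall f, dom W f -> W f = 0%R -> f = 0%R) ->
  is_polar W J absW ->
  is_positive_sqrt S absW ->
  is_HW W J j ->
  is_sqrt_embedding S j ->
  is_continuous_extension S j U ->
  (forall (n : nat) (eta : 'I_n -> M -> H) (a b : R),
     hilbert_frame nu eta a b <->
     krein_frame nu (fun i x => inv_fun U (eta i x)) a b) /\
  (forall (n : nat) (eta : 'I_n -> M -> H) (a b : R),
     (forall i x, dom (op_inv S) (eta i x)) ->
     hilbert_frame nu eta a b ->
     krein_frame nu (fun i x => inv_fun U (eta i x)) a b /\
     forall i x, inv_fun U (eta i x) = j (op_inv S (eta i x))).
Proof.
move=> _ kerW polW sqrtS HW embS extU.
have frameE n (eta : 'I_n -> M -> H) (a b : R) :
    hilbert_frame nu eta a b <->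
    krein_frame nu (fun i x => inv_fun U (eta i x)) a b.
  exact: (frame_inv_fun polW sqrtS HW embS extU kerW).
split=> // n eta a b etaS frame; split; first exact/frameE.
move=> i x.
exact: (inv_fun_sqrt polW sqrtS HW embS extU kerW (etaS i x)).
Qed.
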